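(* Let $A$ be an $n$-element finite algebra and let $\Theta\in\mathrm{Con}(A)$. Then $$\mathrm{En}(\Theta)=2\cdot(n-|A/\Theta|)=2\cdot h_{\mathrm{eq}}(\Theta)$$ and $$\mathrm{CE}(A)=2n\cdot|\mathrm{Con}(A)|-2\cdot\sum_{\Theta\in\mathrm{Con}(A)}|A/\Theta|=2\cdot\sum_{\Theta\in\mathrm{Con}(A)}h_{\mathrm{eq}}(\Theta).$$
   Context: An algebra $A=(A,F)$ is a nonempty set $A$ with a set $F$ of finitary operations (of any type); $\mathrm{Con}(A)$ is its lattice of congruences, ordered by inclusion. $|A/\Theta|$ is the number of blocks of $\Theta$. $\mathrm{Equ}(A)$ is the lattice of all equivalence relations on the set $A$, ordered by inclusion, and $h_{\mathrm{eq}}(\Theta)$ denotes the height of $\Theta$ in $\mathrm{Equ}(A)$ (not in $\mathrm{Con}(A)$), i.e. the length of a longest chain from the equality relation to $\Theta$ in $\mathrm{Equ}(A)$, so the equality relation has height $0$ and $A\times A$ has height $|A|-1$. Energy. Let $A=\{a_1,\dots,a_n\}$ be an $n$-element algebra and $\alpha\in\mathrm{Con}(A)$. The adjacency matrix of $\alpha$ is the symmetric real matrix $M(\alpha)=(m_{ij})_{n\times n}$ with $m_{ij}=1$ if $a_i\ne a_j$ and $(a_i,a_j)\in\alpha$, and $m_{ij}=0$ otherwise. Its characteristic polynomial factors as $\prod_{j=1}^n(x-x_j)$ with $x_1,\dots,x_n\in\mathbb{R}$, and the energy of $\alpha$ is $\mathrm{En}(\alpha):=\sum_{j=1}^n|x_j|$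 (eigenvalues counted with multiplicity; this does not depend on the order in which the elements are listed). The congruence energy of the finite algebra $A$ is $\mathrm{CE}(A):=\sum_{\alpha\in\mathrm{Con}(A)}\mathrm{En}(\alpha)$. *)

(* Defs.v *)
From mathcomp Require Import all_boot all_order all_algebra.
From mathcomp Require Import boolp classical_sets reals.
From mathcomp Require Import sesquilinear spectral.
From mathcomp.real_closed Require Import complex.

Set Implicit Arguments.
Unset Strict Implicit.
Unset Printing Implicit Defensive.

Import Order.TTheory GRing.Theory Num.Theory.
Local Open Scope ring_scope.

(* [ops] is an arbitrary, possibly infinite, set of operations; arity 0 is
   allowed. *)
Record finAlgebra := FinAlgebra {
  carrier :> finType;
  carrier_gt0 : (0 < #|carrier|)%N;
  ops : set {k : nat & k.-tuple carrier -> carrier}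
}.

Section Equivalences.
Variable T : finType.

(* Binary relations on T are finite sets of pairs, so that relations can be
   counted and summed over, and \subset is their inclusion. *)
Definition rel_of (r : {set T * T}) : rel T := fun x y => (x, y) \in r.

Definition is_equivalence (r : {set T * T}) : Prop :=
  [/\ reflexive (rel_of r), symmetric (rel_of r) & transitive (rel_of r)].

Definition Equ : {set {set T * T}} := [set r | `[< is_equivalence r >]].

Definition equality_rel : {set T * T} := [set p | p.1 == p.2].

Definition blocks (r : {set T * T}) : {set {set T}} :=
  equivalence_partition (rel_of r) [set: T].

Definition is_chain (C : {set {set T * T}}) : bool :=
  [forall r in C, forall s in C, (r \subset s) || (s \subset r)].

Definition chain_in_Equ (r s : {set T * T}) (C : {set {set T * T}}) : bool :=
  [&& C \subset Equ, is_chain C, r \in C, s \in C &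
      [forall t in C, (r \subset t) && (t \subset s)]].

(* The length of a finite chain is its number of elements minus one. *)
Definition h_eq (r : {set T * T}) : nat :=
  \max_(C : {set {set T * T}} | chain_in_Equ equality_rel r C) #|C|.-1.

End Equivalences.

Definition compatible (A : finAlgebra) (r : {set A * A}) : Prop :=
  forall (k : nat) (f : k.-tuple A -> A),
    ops (existT (fun k => k.-tuple A -> A) k f) ->
  forall x y : k.-tuple A,
    (forall i, rel_of r (tnth x i) (tnth y i)) -> rel_of r (f x) (f y).

Definition Con (A : finAlgebra) : {set {set A * A}} :=
  [set r in Equ A | `[< compatible r >]].

Section Energy.
Variable R : realType.

(* The eigenvalues with multiplicity: a sequence x_1, ..., x_n such that the
   characteristic polynomial is the product of the 'X - x_j. It is unique up to
   order, and exists for symmetric matrices (char_poly_eigenvalues). *)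
Definition eigenvalues (n : nat) (M : 'M[R]_n) : seq R :=
  xget [::] (fun s : seq R => char_poly M = \prod_(x <- s) ('X - x%:P)).

(* The elements of T are listed as enum_val 0, ..., enum_val (#|T| - 1). *)
Definition adjmx (T : finType) (r : {set T * T}) : 'M[R]_#|T| :=
  \matrix_(i, j) ((enum_val i != enum_val j) &&
                  rel_of r (enum_val i) (enum_val j))%:R.

Definition En (T : finType) (r : {set T * T}) : R :=
  \sum_(x <- eigenvalues (adjmx r)) `|x|.

Definition CE (A : finAlgebra) : R := \sum_(alpha in Con A) En alpha.

Lemma char_poly_eigenvalues (n : nat) (M : 'M[R]_n) :
  M^T = M -> char_poly M = \prod_(x <- eigenvalues M) ('X - x%:P).
Proof.
move=> Msym; apply: (@xgetPex _ [::]
  (fun s : seq R => char_poly M = \prod_(x <- s) ('X - x%:P))).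
pose B := map_mx (real_complex R) M.
have Bherm : B \is hermsymmx.
  apply: realsym_hermsym; last by apply/mxOverP => i j; rewrite mxE complex_real.
  by apply/is_hermitianmxP; rewrite expr0 scale1r map_mx_id // /B map_trmx Msym.
have /orthomx_spectralP Bsp := hermitian_normalmx Bherm.
have /mxOverP Dreal := hermitian_spectral_diag_real Bherm.
exists [seq complex.Re (spectral_diag B 0 i) | i <- enum 'I_n].
apply: (map_poly_inj (real_complex R)).
rewrite map_char_poly -/B rmorph_prod big_map big_enum /=.
set P := spectralmx B in Bsp; set D := spectral_diag B in Bsp Dreal *.
have -> : char_poly B = char_poly (diag_mx D).
  have Pu : P \in unitmx by apply: spectral_unit.
  have Pdet : (\det (map_mx polyC (invmx P))) * (\det (map_mx polyC P)) = 1.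
    by rewrite -det_mulmx -map_mxM mulVmx // map_mx1 det1.
  rewrite /char_poly -[RHS]mul1r -Pdet mulrAC -!det_mulmx; congr (\det _).
  rewrite /char_poly_mx mulmxBr scalar_mxC mulmxBl -!map_mxM -Bsp.
  by rewrite -mulmxA -map_mxM mulVmx // map_mx1 mulmx1.
rewrite char_poly_trig ?diag_mx_is_trig //; apply: eq_bigr => i _.
rewrite rmorphB /= map_polyX map_polyC /= RRe_real ?Dreal //.
by rewrite mxE eqxx mulr1n.
Qed.

End Energy.

(* Main.v *)
Require Import Defs.
From mathcomp Require Import all_boot all_order all_algebra.
From mathcomp Require Import boolp reals.
Local Open Scope ring_scope.

Set Implicit Arguments.
Unset Strict Implicit.
Unset Printing Implicit Defensive.

Import Order.TTheory GRing.Theory Num.Theory.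

(** The energy. Let [Z] be the 0/1 incidence matrix of elements against blocks
    of an equivalence with [n] elements and [k] blocks. Then [Z Z^T] is the
    adjacency matrix plus the identity, while [Z^T Z] is the diagonal matrix of
    the block sizes, so Sylvester's determinant identity determines the
    eigenvalues: [|B| - 1] once for each block [B], and [-1] with
    multiplicity [n - k]. As the block sizes add up to [n], the positive
    eigenvalues have sum [n - k] too.

    The height. The number of blocks is strictly decreasing along a chain of
    equivalences, which bounds the height by [n - k]; the bound is attained
    because detaching one element from a nontrivial block creates exactly one
    more block. *)

(** Both sides equal [t ^+ k * \det M]: clearing [B] from [M] by column operations leaves
    [t%:M - A *m B]. Clearing it by rows, after scaling the lower rows by [t], leaves
    [t%:M - B *m A]. No division by [t] occurs, so [t] may be a polynomial. *)
Lemma sylvester_det (S : comNzRingType) (n k : nat) (A : 'M[S]_(n, k))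
    (B : 'M[S]_(k, n)) (t : S) :
  t ^+ k * \det (t%:M - A *m B) = t ^+ n * \det (t%:M - B *m A).
Proof.
pose M := block_mx t%:M A B 1%:M.
have detM : \det M = \det (t%:M - A *m B).
  have : \det (M *m block_mx 1%:M 0 (- B) 1%:M) = \det (t%:M - A *m B).
    rewrite mulmx_block !mulmx1 !mulmx0 !mul1mx !add0r mulmxN subrr.
    by rewrite det_ublock det1 mulr1.
  by rewrite det_mulmx det_lblock !det1 !mulr1.
have : \det (block_mx 1%:M 0 (- B) t%:M *m M) = t ^+ n * \det (t%:M - B *m A).
  rewrite mulmx_block !mul1mx !mul0mx !addr0 mulmx1 mulNmx scalar_mxC addNr.
  by rewrite det_ublock det_scalar mulNmx addrC.
by rewrite det_mulmx det_lblock det1 mul1r det_scalar detM.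
Qed.

(** * Equivalence relations and their blocks *)

Section Blocks.
Variable T : finType.
Implicit Types (r s : {set T * T}) (B : {set T}).

Definition eq_class r (x : T) : {set T} := [set y | (x, y) \in r].

Lemma EquP r : reflect (is_equivalence r) (r \in Equ T).
Proof. by rewrite inE; apply: asboolP. Qed.

Lemma blocksE r : blocks r = [set eq_class r x | x : T].
Proof.
rewrite /blocks /equivalence_partition; apply/setP => B.
by apply/imsetP/imsetP => -[x _ ->]; exists x => //; apply/setP => y;
  rewrite !inE.
Qed.

Lemma eq_class_blocks r x : eq_class r x \in blocks r.
Proof. by rewrite blocksE imset_f. Qed.

Lemma mem_eq_class r x : is_equivalence r -> x \in eq_class r x.
Proof. by case=> rr _ _; rewrite inE; apply: rr. Qed.

Lemma eq_eq_class r x y : is_equivalence r ->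
  (eq_class r x == eq_class r y) = ((x, y) \in r).
Proof.
move=> r_eq; have [_ rs rt] := r_eq; apply/eqP/idP => [exy | rxy].
  by have := mem_eq_class y r_eq; rewrite -exy inE.
have ryx : (y, x) \in r by rewrite -[_ \in _]/(rel_of r y x) rs.
by apply/setP => z; rewrite !inE; apply/idP/idP; apply: rt.
Qed.

Lemma blocks_eq_class r B x : is_equivalence r ->
  B \in blocks r -> x \in B -> B = eq_class r x.
Proof.
move=> r_eq; rewrite blocksE => /imsetP[y _ ->]; rewrite inE => ryx.
by apply/eqP; rewrite eq_eq_class.
Qed.

Lemma sum_card_blocks r : is_equivalence r ->
  \sum_(B in blocks r) #|B| = #|T|.
Proof.
case=> rr rs rt; rewrite -cardsT; apply/esym/card_partition.
apply: equivalence_partitionP => x y z _ _ _; split=> [|rxy]; first exact: rr.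
by apply/idP/idP; apply: rt; rewrite // rs.
Qed.

Lemma card_blocks_gt0 r B : is_equivalence r -> B \in blocks r -> (0 < #|B|)%N.
Proof.
move=> r_eq; rewrite blocksE => /imsetP[x _ ->].
by apply/card_gt0P; exists x; apply: mem_eq_class.
Qed.

Lemma leq_card_blocks r : (#|blocks r| <= #|T|)%N.
Proof. by rewrite blocksE leq_imset_card. Qed.

Lemma equality_is_equivalence : is_equivalence (equality_rel T).
Proof.
split=> [x|x y|y x z]; rewrite /rel_of !inE //=.
by move=> /eqP-> /eqP->.
Qed.

Lemma card_blocks_equality : #|blocks (equality_rel T)| = #|T|.
Proof.
rewrite blocksE card_imset // => x y /eqP.
by rewrite eq_eq_class ?inE => [/eqP|]; last exact: equality_is_equivalence.
Qed.

Lemma equality_sub r : is_equivalence r -> equality_rel T \subset r.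
Proof.
by case=> rr _ _; apply/subsetP => -[x y]; rewrite inE => /eqP /= <-; apply: rr.
Qed.

(** The map [f] sends the [r]-class of [x] to its [s]-class. It is onto [blocks s], and it is
    injective exactly when the two relations agree. *)
Lemma card_blocks_sub r s : is_equivalence r -> is_equivalence s ->
  r \subset s -> (#|blocks s| <= #|blocks r| ?= iff (r == s))%N.
Proof.
move=> r_eq s_eq rs; pose f B := \bigcup_(x in B) eq_class s x.
have fE x : f (eq_class r x) = eq_class s x.
  apply/setP => z; apply/bigcupP/idP => [[y]|sxz].
    rewrite inE => /(subsetP rs); rewrite -eq_eq_class // => /eqP-> //.
  by exists x => //; apply: mem_eq_class.
have bE : blocks s = f @: blocks r.
  by rewrite !blocksE -imset_comp; apply: eq_imset => x /=; rewrite fE.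
rewrite bE; split; first exact: leq_imset_card.
apply/imset_injP/eqP => [f_inj | rsE].
  apply/eqP; rewrite eqEsubset rs; apply/subsetP => -[x y] sxy.
  by rewrite -eq_eq_class //; apply/eqP/f_inj; rewrite ?eq_class_blocks //;
    rewrite !fE; apply/eqP; rewrite eq_eq_class.
by apply/imset_injP; rewrite -bE rsE.
Qed.

Lemma refine_equivalence r : is_equivalence r -> r != equality_rel T ->
  exists r', [/\ is_equivalence r', r' \proper r &
                 (#|blocks r'| <= #|blocks r|.+1)%N].
Proof.
move=> r_eq rN; have [rr rs rt] := r_eq.
have /subsetPn[[x y] rxy] : ~~ (r \subset equality_rel T).
  by apply: contra rN => re; rewrite eqEsubset re equality_sub.
rewrite inE /= => xy.
(* Keeping the pairs in which both or neither component is [x] makes [x] a singleton block and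
   removes it from its old block. *)
pose r' := [set p in r | (p.1 == x) == (p.2 == x)].
have r'E u v : rel_of r' u v = rel_of r u v && ((u == x) == (v == x)).
  by rewrite /rel_of inE.
exists r'; split.
- split=> [u|u v|v u w]; rewrite !r'E ?eqxx ?andbT; first exact: rr.
    by rewrite rs eq_sym.
  by move=> /andP[ruv /eqP->] /andP[rvw ->]; rewrite (rt _ _ _ ruv rvw).
- apply/properP; split; first by apply/subsetP => p; rewrite inE => /andP[].
  exists (x, y) => //; rewrite -[_ \in _]/(rel_of r' x y) r'E eqxx eq_sym.
  by rewrite [y == x]eq_sym (negPf xy) andbF.
have sub : blocks r' \subset [set x] |: [set B :\ x | B in blocks r].
  rewrite blocksE; apply/subsetP => _ /imsetP[u _ ->]; apply/setU1P.
  have [->|ux] := eqVneq u x; [left | right].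
    apply/setP => z; rewrite [LHS]inE -[LHS]/(rel_of r' x z) r'E eqxx inE.
    by have [->|_] := eqVneq z x; rewrite ?rr ?andbF.
  apply/imsetP; exists (eq_class r u); first exact: eq_class_blocks.
  apply/setP => z; rewrite [LHS]inE -[LHS]/(rel_of r' u z) r'E (negPf ux) !inE.
  by rewrite andbC; case: (z == x).
apply: leq_trans (subset_leq_card sub) _.
by rewrite cardsU1 -add1n leq_add ?leq_b1 // leq_imset_card.
Qed.

(** * The height in the lattice of equivalences *)

Lemma card_chain_in_Equ r C : chain_in_Equ (equality_rel T) r C ->
  (#|C|.-1 <= #|T| - #|blocks r|)%N.
Proof.
case/and5P=> /subsetP C_Equ C_chain _ rC /forall_inP C_le.
have r_eq := EquP _ (C_Equ _ rC).
have inj : {in enum C &, injective (fun s => #|blocks s|)}.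
  move=> s t; rewrite !mem_enum => sC tC /eqP st.
  have [/EquP s_eq /EquP t_eq] := (C_Equ _ sC, C_Equ _ tC).
  have /orP[le|le] := forall_inP (forall_inP C_chain _ sC) _ tC.
    by apply/eqP; rewrite -(card_blocks_sub s_eq t_eq le) eq_sym.
  by apply/esym/eqP; rewrite -(card_blocks_sub t_eq s_eq le).
have Uc : uniq [seq #|blocks s| | s <- enum C].
  by rewrite map_inj_in_uniq ?enum_uniq.
(* The block counts are distinct and lie between [#|blocks r|] and [#|T|], both included; the
   resulting [.+1] is offset by the [.-1] in the length of a chain. *)
have := uniq_leq_size (s2 := iota #|blocks r| (#|T| - #|blocks r|).+1) Uc.
rewrite size_map size_iota -cardE -subn1 leq_subLR add1n; apply=> n.
move=> /mapP[s]; rewrite mem_enum => sC ->.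
have /EquP s_eq := C_Equ _ sC; have /andP[_ sr] := C_le _ sC.
rewrite mem_iota (card_blocks_sub s_eq r_eq sr) addnS ltnS.
by rewrite subnKC ?leq_card_blocks.
Qed.

Lemma chain_in_Equ_setU1 r s C : is_equivalence r -> is_equivalence s ->
  s \subset r -> chain_in_Equ (equality_rel T) s C ->
  chain_in_Equ (equality_rel T) r (r |: C).
Proof.
move=> r_eq s_eq sr /and5P[C_Equ C_chain eC sC /forall_inP C_le].
have tr t : t \in C -> t \subset r.
  by move=> /C_le/andP[_ ts]; apply: subset_trans ts sr.
apply/and5P; split.
- by rewrite subUset C_Equ sub1set andbT; apply/EquP.
- apply/forall_inP => t tC; apply/forall_inP => u uC.
  case/setU1P: tC => [->|tC]; case/setU1P: uC => [->|uC];
    rewrite ?subxx ?(tr t tC) ?(tr u uC) ?orbT //.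
  exact: forall_inP (forall_inP C_chain _ tC) _ uC.
- by rewrite setU1r.
- by rewrite setU11.
- apply/forall_inP => t /setU1P[->|tC]; first by rewrite subxx equality_sub.
  by rewrite tr // andbT; case/andP: (C_le _ tC).
Qed.

(** Induction on the number of pairs in [r]: a chain for a refinement with at most one more block is
    extended by [r] at the top. The strict bound counts members, one more than the length. *)
Lemma exists_chain_in_Equ r : is_equivalence r ->
  exists2 C, chain_in_Equ (equality_rel T) r C &
             (#|T| - #|blocks r| < #|C|)%N.
Proof.
have [m] := ubnP #|r|; elim: m r => // m IHm r; rewrite ltnS => r_m r_eq.
have [->|rN] := eqVneq r (equality_rel T).
  exists [set equality_rel T]; last by rewrite card_blocks_equality subnn cards1.
  rewrite /chain_in_Equ /is_chain sub1set set11 !andTb.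
  apply/and3P; split; first exact/EquP/equality_is_equivalence.
    by apply/forall_inP => s /set1P->; apply/forall_inP => t /set1P->;
      rewrite subxx.
  by apply/forall_inP => s /set1P->; rewrite subxx.
have [s [s_eq s_r bs]] := refine_equivalence r_eq rN.
have [C CP C_card] := IHm s (leq_trans (proper_card s_r) r_m) s_eq.
exists (r |: C); first exact: chain_in_Equ_setU1 s_eq (proper_sub s_r) CP.
(* All members of [C] lie below [s], which is strictly below [r]. *)
have rC : r \notin C.
  apply/negP => rC; case/and5P: CP => _ _ _ _ /forall_inP /(_ _ rC)/andP[_].
  by apply/negP; rewrite proper_subn.
rewrite cardsU1 rC add1n ltnS; apply: leq_trans C_card.
rewrite leq_subLR addnS -addSn.
by apply: leq_trans (leq_add bs (leqnn _)); rewrite -leq_subLR.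
Qed.

Lemma h_eqE r : is_equivalence r -> h_eq r = (#|T| - #|blocks r|)%N.
Proof.
move=> r_eq; apply/eqP; rewrite eqn_leq; apply/andP; split.
  by apply/bigmax_leqP => C; apply: card_chain_in_Equ.
have [C CP C_card] := exists_chain_in_Equ r_eq.
by apply: (leq_trans _ (leq_bigmax_cond _ CP)); case: #|C| C_card.
Qed.

End Blocks.

(** * Spectrum and energy of an equivalence *)

Section Energy.
Variables (R : realType) (T : finType) (r : {set T * T}).
Hypothesis r_eq : is_equivalence r.

Let block (i : 'I_#|blocks r|) : {set T} := enum_val i.
Let incidence : 'M[R]_(#|T|, #|blocks r|) :=
  \matrix_(i, j) (enum_val i \in block j)%:R.

(** Each entry counts the blocks containing both elements, and only the class of the first can be
    one. The identity matrix supplies the diagonal, which is zero in [adjmx]. *)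
Lemma incidence_mul_tr : incidence *m incidence^T = adjmx R r + 1%:M.
Proof.
apply/matrixP => i j; rewrite !mxE; set x := enum_val i; set y := enum_val j.
have kb : eq_class r x \in blocks r by apply: eq_class_blocks.
rewrite (bigD1 (enum_rank_in kb (eq_class r x))) //= big1 => [|l lN].
  rewrite !mxE /block enum_rankK_in // mem_eq_class // mul1r addr0 inE.
  rewrite -(inj_eq enum_val_inj i j) -/x -/y /rel_of -natrD.
  have [<-|_] := eqVneq x y; last by rewrite addn0.
  by have [rr _ _] := r_eq; rewrite [_ \in _]rr.
rewrite !mxE -/x; case: (boolP (x \in block l)) => [xl|_]; last by rewrite mul0r.
case/eqP: lN; apply: enum_val_inj; rewrite enum_rankK_in //.
by apply: blocks_eq_class xl => //; apply: enum_valP.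
Qed.

Lemma tr_mul_incidence :
  incidence^T *m incidence = diag_mx (\row_j #|block j|%:R).
Proof.
apply/matrixP => j l; rewrite !mxE.
transitivity (\sum_(x : T) (x \in block j)%:R * (x \in block l)%:R : R).
  by rewrite [RHS](reindex _ (onW_bij _ (enum_val_bij T)));
    apply: eq_bigr => i _; rewrite !mxE.
have [<-|jl] := eqVneq j l.
  rewrite mulr1n -sum1_card natr_sum [RHS]big_mkcond; apply: eq_bigr => x _.
  by case: (x \in _); rewrite ?mulr1 ?mulr0.
rewrite mulr0n big1 // => x _; rewrite -natrM mulnb.
case: andP => // -[xj xl]; case/eqP: jl; apply: enum_val_inj.
by rewrite [LHS](blocks_eq_class r_eq (enum_valP j) xj)
           [RHS](blocks_eq_class r_eq (enum_valP l) xl).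
Qed.

(** Sylvester's identity at [t = 'X + 1], written as the linear factor of the eigenvalue [-1].
    Powers of [t] stay on both sides, so no polynomial division is needed. *)
Lemma char_poly_adjmx :
  ('X - (-1)%:P) ^+ #|blocks r| * char_poly (adjmx R r) =
  ('X - (-1)%:P) ^+ #|T| *
    \prod_(B in blocks r) ('X - (#|B|%:R - 1 : R)%:P).
Proof.
have E : adjmx R r = incidence *m incidence^T - 1%:M.
  by rewrite incidence_mul_tr addrK.
set t : {poly R} := 'X - (-1)%:P.
have -> : char_poly (adjmx R r) =
    \det (t%:M - map_mx polyC incidence *m map_mx polyC incidence^T).
  rewrite /char_poly /char_poly_mx E map_mxB map_mx1 map_mxM opprB addrA.
  by congr (\det (_ - _)); rewrite /t polyCN opprK raddfD.
rewrite sylvester_det -map_mxM tr_mul_incidence; congr (_ * _).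
have -> : t%:M - map_mx polyC (diag_mx (\row_j #|block j|%:R)) =
    diag_mx (\row_j ('X - (#|block j|%:R - 1 : R)%:P)).
  apply/matrixP => i j; rewrite !mxE; case: (i == j); last first.
    by rewrite !mulr0n polyC0 subrr.
  by rewrite !mulr1n /t polyCB polyCN opprB opprK -addrA [1 - _]addrC.
rewrite det_diag [RHS]big_enum_val.
by apply: eq_bigr => i _; rewrite mxE.
Qed.

Lemma En_equivalence : En R r = 2 * (#|T|%:R - #|blocks r|%:R).
Proof.
have sym : (adjmx R r)^T = adjmx R r.
  have [_ rs _] := r_eq.
  by apply/matrixP => i j; rewrite !mxE eq_sym rs.
have := char_poly_adjmx; rewrite (char_poly_eigenvalues sym).
set s := eigenvalues _; pose u := [seq #|B|%:R - 1 : R | B : {set T} <- enum (blocks r)].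
have powE n : ('X - (-1)%:P) ^+ n = \prod_(x <- nseq n (-1 : R)) ('X - x%:P).
  by rewrite big_nseq iter_mulr_1.
(* With both sides written as products of monic linear factors, unique factorization makes the two
   lists of roots permutations of each other. *)
rewrite !powE -big_enum -[X in _ * X = _]/(\prod_(x <- s) _).
rewrite -(big_map (fun B : {set T} => #|B|%:R - 1 : R) xpredT
                  (fun x => 'X - x%:P)) -/u -!big_cat => /prod_XsubC_eq su.
have : \sum_(x <- nseq #|blocks r| (-1 : R) ++ s) `|x| =
       \sum_(x <- nseq #|T| (-1) ++ u) `|x| by apply: perm_big.
have nseqE n : \sum_(x <- nseq n (-1 : R)) `|x| = n%:R.
  by rewrite big_nseq normrN1 iter_addr_0.
rewrite !big_cat !nseqE /= -/(En R r).
(* Blocks are nonempty, so each [#|B| - 1] is its own absolute value, and the block sizes add up to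
   [#|T|]. *)
have -> : \sum_(x <- u) `|x| = #|T|%:R - #|blocks r|%:R.
  rewrite /u big_map big_enum /= -(sum_card_blocks r_eq) natr_sum.
  rewrite -sum1_card natr_sum -sumrB; apply: eq_bigr => B Bb.
  by rewrite ger0_norm // subr_ge0 ler1n (card_blocks_gt0 r_eq).
by move=> /(canRL (addKr _)) ->; rewrite addrA [- _ + _]addrC mulr_natl mulr2n.
Qed.

End Energy.

Theorem mainTheorem2 (R : realType) (A : finAlgebra) (n : nat)
    (hn : #|A| = n) (Theta : {set A * A}) (hTheta : Theta \in Con A) :
  (En R Theta = 2 * (n%:R - #|blocks Theta|%:R) /\
   2 * (n%:R - #|blocks Theta|%:R) = 2 * (h_eq Theta)%:R :> R) /\
  (CE R A = 2 * n%:R * #|Con A|%:R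
            - 2 * \sum_(alpha in Con A) #|blocks alpha|%:R /\
   2 * n%:R * #|Con A|%:R - 2 * \sum_(alpha in Con A) #|blocks alpha|%:R
     = 2 * \sum_(alpha in Con A) (h_eq alpha)%:R :> R).
Proof.
subst n.
have ConP (r : {set A * A}) : r \in Con A -> is_equivalence r.
  by rewrite inE => /andP[/EquP].
(* There are at most [#|A|] blocks, so the truncated subtraction of [h_eqE] becomes a true one in
   [R]. *)
have hE (r : {set A * A}) : r \in Con A ->
    (h_eq r)%:R = #|A|%:R - #|blocks r|%:R :> R.
  by move=> /ConP r_eq; rewrite h_eqE // natrB ?leq_card_blocks.
have sumE : \sum_(alpha in Con A) (#|A|%:R - #|blocks alpha|%:R : R) =
    #|A|%:R * #|Con A|%:R - \sum_(alpha in Con A) #|blocks alpha|%:R.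
  by rewrite sumrB sumr_const mulr_natr.
split; first by rewrite hE // En_equivalence //; apply: ConP.
rewrite -mulrA -mulrBr (eq_bigr _ hE) sumE; split=> //.
by rewrite -sumE /CE mulr_sumr; apply: eq_bigr => r /ConP/En_equivalence.
Qed.
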